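(* There is no superhigh weakly 2-random set; that is, no set $R\subseteq\mathbb{N}$ is both superhigh and weakly 2-random.
   Context: A set $A$ is superhigh if $A'\ge_{tt}\emptyset''$, where $A'$ is the Turing jump of $A$ and $\le_{tt}$ is truth-table reducibility. A set $R$ is weakly 2-random if $R$ belongs to no (lightface) $\Pi^0_2$ class $\mathcal{S}\subseteq 2^{\mathbb{N}}$ that is null, i.e. has fair-coin Lebesgue measure $0$. *)

(* Defs.v *)
From Stdlib Require Cantor.
From mathcomp Require Import all_boot all_order all_algebra.
From mathcomp Require Import all_classical all_reals ereal topology normedtype.
From mathcomp Require Import sequences.
Set Implicit Arguments.
Unset Strict Implicit.
Unset Printing Implicit Defensive.

Import Order.TTheory GRing.Theory Num.Theory.
Local Open Scope classical_set_scope.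

(* Subsets of N and points of 2^N are both elements of [set nat]; classes are
   elements of [set (set nat)]. *)

Definition npair (x y : nat) : nat := Cantor.to_nat (x, y).
Definition nfst (z : nat) : nat := (Cantor.of_nat z).1.
Definition nsnd (z : nat) : nat := (Cantor.of_nat z).2.

Fixpoint seq_code (s : seq nat) : nat :=
  if s is x :: s' then (npair x (seq_code s')).+1 else 0.

Definition string_code (s : seq bool) : nat := seq_code (map nat_of_bool s).

(* Programs for the partial recursive functions with an oracle; functions of
   several arguments are unary functions of a coded tuple. *)
Inductive prog : Type :=
| Zero
| Succ
| Fst
| Snd
| Oracle
| Pair of prog & prog
| Comp of prog & prog
| Prec of prog & prog
| Mu of prog.

(* [peval A p x y]: with oracle A, program p halts on input x with output y.
   - [Prec p q] computes h with h(a,0) = p(a), h(a,n+1) = q(a,(n,h(a,n)));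
   - [Mu p] maps x to the least y with p(x,y) = 0, where p(x,i) has to be
     defined (and nonzero) for every i < y. *)
Fixpoint peval (A : set nat) (p : prog) : nat -> nat -> Prop :=
  match p with
  | Zero => fun _ y => y = 0
  | Succ => fun x y => y = x.+1
  | Fst => fun x y => y = nfst x
  | Snd => fun x y => y = nsnd x
  | Oracle => fun x y => y = nat_of_bool `[< A x >]
  | Pair p q => fun x y =>
      exists u v, [/\ peval A p x u, peval A q x v & y = npair u v]
  | Comp p q => fun x y => exists2 u, peval A q x u & peval A p u y
  | Prec p q => fun x =>
      (fix rec (n : nat) : nat -> Prop :=
         if n is m.+1 then fun y =>
           exists2 u, rec m u & peval A q (npair (nfst x) (npair m u)) y
         else peval A p (nfst x)) (nsnd x)
  | Mu p => fun x y => peval A p (npair x y) 0 /\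
      forall i, i < y -> exists k, peval A p (npair x i) k.+1
  end.

Definition halts (A : set nat) (p : prog) (x : nat) : Prop :=
  exists y, peval A p x y.

Fixpoint prog_code (p : prog) : nat :=
  match p with
  | Zero => npair 0 0
  | Succ => npair 1 0
  | Fst => npair 2 0
  | Snd => npair 3 0
  | Oracle => npair 4 0
  | Pair p q => npair 5 (npair (prog_code p) (prog_code q))
  | Comp p q => npair 6 (npair (prog_code p) (prog_code q))
  | Prec p q => npair 7 (npair (prog_code p) (prog_code q))
  | Mu p => npair 8 (prog_code p)
  end.

(* The e-th partial A-recursive function is the one computed by the program
   with code e, and is nowhere defined when e is not the code of a program. *)
Definition jump (A : set nat) : set nat :=
  [set e | exists2 p, prog_code p = e & halts A p e].

Definition computable (f : nat -> nat) : Prop :=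
  exists p, forall x, peval set0 p x (f x).

(* A truth-table condition: a list of queries, and the rows of answers for
   which the truth table has the value true. *)
Definition ttcond : Type := (seq nat * seq (seq bool))%type.

Definition ttcond_code (t : ttcond) : nat :=
  npair (seq_code t.1) (seq_code (map string_code t.2)).

Definition ttsat (A : set nat) (t : ttcond) : Prop :=
  [seq `[< A q >] | q <- t.1] \in t.2.

Definition tt_reducible (B A : set nat) : Prop :=
  exists t : nat -> ttcond,
    computable (fun n => ttcond_code (t n)) /\
    forall n, B n <-> ttsat A (t n).

Definition superhigh (A : set nat) : Prop :=
  tt_reducible (jump (jump set0)) (jump A).

Definition restr (X : set nat) (m : nat) : seq bool :=
  [seq `[< X i >] | i <- iota 0 m].

(* Computability of a relation between numbers and binary strings: its
   characteristic function is computable. *)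
Definition computable_rel (P : nat -> seq bool -> bool) : Prop :=
  exists2 f, computable f &
    forall n s, f (npair n (string_code s)) = nat_of_bool (P n s).

Definition Pi02_class (S : set (set nat)) : Prop :=
  exists2 P, computable_rel P &
    S = [set X | forall n, exists m, P n (restr X m)].

Definition cylinder (s : seq bool) : set (set nat) :=
  [set X | restr X (size s) = s].

(* Fair-coin outer measure induced by [cylinder s |-> 2^-(size s)]; the
   fair-coin measure is its restriction to the measurable classes, which
   include all Pi^0_2 classes. *)
Definition coin_measure (K : realType) (S : set (set nat)) : \bar K :=
  ereal_inf
    [set (\sum_(0 <= k <oo) (((2 : K) ^- size (C k))%R)%:E)%E
    | C in [set C : nat -> seq bool | S `<=` \bigcup_k cylinder (C k)]].

Definition null_class (K : realType) (S : set (set nat)) : Prop :=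
  coin_measure K S = 0%E.

Definition weakly_2_random (K : realType) (R : set nat) : Prop :=
  forall S, Pi02_class S -> null_class K S -> ~ S R.

(* Main.v *)
(** Let [t] be a truth-table reduction. Call "block n" a list of n numbers and
    let Gamma(X, n) be the string of the n answers that [t], with oracle X',
    gives on block n. The queries of [t] on block n are finitely many
    Sigma^0_1 events, so there is a stage s after which their approximations
    change only with measure at most 2^-n; the least such s is found by 0'.
    At stage s some string sigma(n) of length n is the value of the
    approximation to Gamma(., n) with probability at most 2^-n, and then
    { X : Gamma(X, n) = sigma(n) } has measure at most 2^(1-n). Hence
    { X : for all n, Gamma(X, n) = sigma(n) } is null, and it equals
    the Pi^0_2 class of the X such that, for all n, the
    approximations to Gamma(X, n) and sigma(n) agree at infinitely many
    stages. Since sigma is computable in 0', the blocks can be chosen as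
    numbers e whose membership in 0'' is the corresponding bit of sigma; so if
    [t] reduces 0'' to R', then R lies in this null class. The blocks depend
    on sigma, which depends on the blocks, but no recursion theorem is needed:
    the jump runs each program on its own code. *)
From Stdlib Require Cantor.
Require Import Defs.
From mathcomp Require Import all_boot all_order all_algebra.
From mathcomp Require Import all_classical all_reals.
From mathcomp Require Import ereal topology normedtype sequences.
From mathcomp Require Import zify ring.
Set Implicit Arguments.
Unset Strict Implicit.
Unset Printing Implicit Defensive.
Import Order.TTheory GRing.Theory Num.Theory.
Local Open Scope classical_set_scope.

(** * Programs and codes *)

Lemma nfstK x y : nfst (npair x y) = x.
Proof. by rewrite /nfst /npair Cantor.cancel_of_to. Qed.

Lemma nsndK x y : nsnd (npair x y) = y.
Proof. by rewrite /nsnd /npair Cantor.cancel_of_to. Qed.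

Lemma npairK z : npair (nfst z) (nsnd z) = z.
Proof.
by rewrite /npair /nfst /nsnd -surjective_pairing Cantor.cancel_to_of.
Qed.

Lemma leq_npair x y : x + y <= npair x y.
Proof. by rewrite addnC; apply/ssrnat.leP/Cantor.to_nat_non_decreasing. Qed.

Lemma npair_inj x y x' y' : npair x y = npair x' y' -> x = x' /\ y = y'.
Proof. by move=> e; rewrite -(nfstK x y) -{2}(nsndK x y) e nfstK nsndK. Qed.

Lemma peval_fun A p x y y' : peval A p x y -> peval A p x y' -> y = y'.
Proof.
elim: p x y y' => [|||||p IHp q IHq|p IHp q IHq|p IHp q IHq|p IHp] /=;
  only 1-5: by move=> x y y' -> ->.
- move=> x y y' [u [v [pu qv ->]]] [u' [v' [pu' qv' ->]]].
  by rewrite (IHp _ _ _ pu pu') (IHq _ _ _ qv qv').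
- move=> x y y' [u qu pu] [u' qu' pu'].
  by move: pu'; rewrite -(IHq _ _ _ qu qu') => /(IHp _ _ _ pu).
- move=> x; elim: (nsnd x) => [|m IH] y y'; first exact: IHp.
  by move=> [u /IH ru qu] [u' /ru <-]; apply: IHq.
- move=> x y y' [py lty] [py' lty'].
  case: (ltngtP y y') => // [/lty'|/lty] [k pk].
    by have := IHp _ _ _ py pk.
  by have := IHp _ _ _ py' pk.
Qed.

(** Answering every query by 0 simulates the empty oracle under any oracle, so computable functions
    can be subroutines of programs with oracle 0'. *)
Fixpoint oracle_free (p : prog) : prog :=
  match p with
  | Oracle => Zero
  | Pair p q => Pair (oracle_free p) (oracle_free q)
  | Comp p q => Comp (oracle_free p) (oracle_free q)
  | Prec p q => Prec (oracle_free p) (oracle_free q)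
  | Mu p => Mu (oracle_free p)
  | p => p
  end.

Lemma peval_oracle_free A p : peval A (oracle_free p) = peval set0 p.
Proof.
elim: p => //= [|p -> q ->|p -> q ->|p -> q ->|p ->] //.
by apply/funext => x; apply/funext => y; rewrite asboolF.
Qed.

Lemma computable_any_oracle f :
  computable f -> exists p, forall A x, peval A p x (f x).
Proof.
by case=> p fp; exists (oracle_free p) => A x; rewrite peval_oracle_free.
Qed.

Definition id_prog := Pair Fst Snd.

Lemma peval_id A x : peval A id_prog x x.
Proof. by exists (nfst x), (nsnd x); rewrite npairK. Qed.

Lemma computable_id : computable id.
Proof. by exists id_prog; apply: peval_id. Qed.

Lemma computable_comp f g : computable f -> computable g -> computable (f \o g).
Proof. by move=> [p fp] [q gq]; exists (Comp p q) => x; exists (g x). Qed.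

Lemma computable_pair f g :
  computable f -> computable g -> computable (fun x => npair (f x) (g x)).
Proof.
by move=> [p fp] [q gq]; exists (Pair p q) => x; exists (f x), (g x).
Qed.

Fixpoint const_prog n := if n is n'.+1 then Comp Succ (const_prog n') else Zero.

Lemma peval_const A n x : peval A (const_prog n) x n.
Proof. by elim: n => //= n IH; exists n. Qed.

Lemma computable_prec f g : computable f -> computable g ->
  computable (fun x => iteri (nsnd x)
    (fun k u => g (npair (nfst x) (npair k u))) (f (nfst x))).
Proof.
move=> [p fp] [q gq]; exists (Prec p q) => x /=.
by elim: (nsnd x) => //= n IH; eexists; first exact: IH.
Qed.

(** * Computable functions between encoded types *)

Structure encType := EncType {
  enc_sort :> Type;
  enc : enc_sort -> nat;
  enc_inj : injective enc
}.
Arguments enc {_} _.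

(* On [nat], [bool], pairs and lists the encodings agree with those of the
   definitions, e.g. with [string_code] on strings and [ttcond_code] on
   truth-table conditions. *)
Definition cmp (T U : encType) (f : T -> U) :=
  exists2 g, computable g & forall x, g (enc x) = enc (f x).

Canonical nat_encType := @EncType nat id (fun _ _ => id).

Lemma nat_of_bool_inj : injective nat_of_bool. Proof. by case; case. Qed.
Canonical bool_encType := EncType nat_of_bool_inj.

Section Product.
Variables T U : encType.
Definition enc_prod (x : T * U) := npair (enc x.1) (enc x.2).
Lemma enc_prod_inj : injective enc_prod.
Proof. by case=> [x y] [x' y'] /npair_inj[/= /enc_inj-> /enc_inj->]. Qed.
Canonical prod_encType := EncType enc_prod_inj.
End Product.

Section Sequence.
Variables T : encType.
Definition enc_seq (s : seq T) := seq_code (map enc s).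
Lemma enc_seq_inj : injective enc_seq.
Proof.
by elim=> [|x s IH] [|y r] //= [] /npair_inj[/enc_inj-> /IH->].
Qed.
Canonical seq_encType := EncType enc_seq_inj.
End Sequence.


Lemma cmp_id (T : encType) : cmp (fun x : T => x).
Proof. by exists id => //; apply: computable_id. Qed.

Lemma cmp_const (T U : encType) (y : U) : cmp (fun _ : T => y).
Proof.
by exists (fun=> enc y) => //; exists (const_prog (enc y)) => x;
  apply: peval_const.
Qed.

Lemma cmp_comp (E T U : encType) (f : T -> U) (g : E -> T) :
  cmp f -> cmp g -> cmp (fun x => f (g x)).
Proof.
move=> [f' cf ff'] [g' cg gg']; exists (f' \o g'); first exact: computable_comp.
by move=> x /=; rewrite gg' ff'.
Qed.

Lemma cmp_pair (E T U : encType) (f : E -> T) (g : E -> U) :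
  cmp f -> cmp g -> cmp (fun x => (f x, g x)).
Proof.
move=> [f' cf ff'] [g' cg gg']; exists (fun x => npair (f' x) (g' x)).
  exact: computable_pair.
by move=> x /=; rewrite gg' ff'.
Qed.

Lemma cmp_fst (E T U : encType) (f : E -> T * U) :
  cmp f -> cmp (fun x => (f x).1).
Proof.
move=> [f' cf ff']; exists (nfst \o f'); last by move=> x /=; rewrite ff' nfstK.
by apply: computable_comp => //; exists Fst.
Qed.

Lemma cmp_snd (E T U : encType) (f : E -> T * U) :
  cmp f -> cmp (fun x => (f x).2).
Proof.
move=> [f' cf ff']; exists (nsnd \o f'); last by move=> x /=; rewrite ff' nsndK.
by apply: computable_comp => //; exists Snd.
Qed.

Lemma cmp_ext (T U : encType) (f g : T -> U) : f =1 g -> cmp f -> cmp g.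
Proof. by move=> fg [f' cf ff']; exists f' => // x; rewrite ff' fg. Qed.

Lemma cmp_iteri (E U : encType) (n : E -> nat) (b : E -> U) (f : E -> nat ->
  U -> U) :
  cmp n -> cmp b -> cmp (fun p : E * (nat * U) => f p.1 p.2.1 p.2.2) ->
  cmp (fun e => iteri (n e) (f e) (b e)).
Proof.
move=> [n' cn nn'] [b' cb bb'] [f' cf ff'].
exists (fun x => iteri (nsnd (npair x (n' x)))
    (fun k u => f' (npair (nfst (npair x (n' x))) (npair k u)))
    (b' (nfst (npair x (n' x))))).
  apply: (computable_comp (computable_prec cb cf)).
  by apply: computable_pair => //; apply: computable_id.
move=> e; rewrite nsndK nfstK nn'; elim: (n e : nat) => //= k ->.
exact: (ff' (e, (k, _))).
Qed.

(** A number is its own code, so a witness for [f] is also one for its codes, up to conversion. *)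
Lemma cmp_enc (E T : encType) (f : E -> T) : cmp f -> cmp (fun e => enc (f e)).
Proof. by []. Qed.

Lemma cmp_app2 (E T V W : encType) (f : T -> V -> W) (g : E -> T) (h : E -> V) :
  cmp (fun x : T * V => f x.1 x.2) -> cmp g -> cmp h ->
  cmp (fun x => f (g x) (h x)).
Proof.
by move=> cf cg ch; apply: (cmp_comp (g := fun x => (g x, h x)) cf);
  apply: cmp_pair.
Qed.

Lemma cmp_npair (E : encType) (f g : E -> nat) :
  cmp f -> cmp g -> cmp (fun e => npair (f e) (g e)).
Proof. by move=> cf cg; apply: (cmp_enc (cmp_pair cf cg)). Qed.

Lemma cmp_nfst (E : encType) (f : E -> nat) :
  cmp f -> cmp (fun e => nfst (f e)).
Proof. by apply: cmp_comp; exists nfst => //; exists Fst. Qed.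

Lemma cmp_nsnd (E : encType) (f : E -> nat) :
  cmp f -> cmp (fun e => nsnd (f e)).
Proof. by apply: cmp_comp; exists nsnd => //; exists Snd. Qed.

Lemma cmp_succ (E : encType) (f : E -> nat) : cmp f -> cmp (fun e => (f e).+1).
Proof. by apply: cmp_comp; exists succn => //; exists Succ. Qed.

Ltac cmp_step :=
  match goal with
  | |- cmp (fun x => x) => apply: cmp_id
  | |- cmp (fun x => ?y) => apply: cmp_const
  | H : cmp ?f |- cmp (fun x => ?f (@?g x)) => refine (cmp_comp (g := g) H _)
  | H : cmp ?f |- cmp ?f => exact: H
  | H : cmp (fun x => ?f x.1 x.2) |- cmp (fun x => ?f (@?g x) (@?h x)) =>
      refine (cmp_app2 (g := g) (h := h) H _ _)
  | H : cmp (fun x => ?f x.1 x.2.1 x.2.2)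
      |- cmp (fun x => ?f (@?g x) (@?h x) (@?k x)) =>
      refine (cmp_comp (g := fun x => (g x, (h x, k x))) H _)
  | |- cmp fst => exact: (cmp_fst (cmp_id _))
  | |- cmp snd => exact: (cmp_snd (cmp_id _))
  | |- cmp (fun x => fst _) => apply: cmp_fst
  | |- cmp (fun x => snd _) => apply: cmp_snd
  | |- cmp (fun x => (_, _)) => apply: cmp_pair
  | |- cmp (fun x => npair _ _) => apply: cmp_npair
  | |- cmp (fun x => nfst _) => apply: cmp_nfst
  | |- cmp (fun x => nsnd _) => apply: cmp_nsnd
  | |- cmp (fun x => (_).+1) => apply: cmp_succ
  end.
(** Hooks of the tactic [cmp], redefined by [::=] as further closure lemmas become available. *)
Ltac cmp_arith := fail.
Ltac cmp_list := fail.
Ltac cmp_user := fail.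
Ltac cmp := cbv beta;
  repeat (first [cmp_step | cmp_arith | cmp_list | cmp_user]; cbv beta).

Lemma cmp_iter (E U : encType) (n : E -> nat) (b : E -> U) (h : E -> U -> U) :
  cmp n -> cmp b -> cmp (fun p : E * U => h p.1 p.2) ->
  cmp (fun e => iter (n e) (h e) (b e)).
Proof.
by move=> cn cb ch; apply: (cmp_iteri (f := fun e _ => h e) cn cb); cmp.
Qed.

(** The last pass of [iteri] sees the index [(f e).-1] and discards the accumulated value. [cmp_if]
    and [cmp_nat_case] branch by the same trick. *)
Lemma cmp_pred (E : encType) (f : E -> nat) : cmp f -> cmp (fun e => (f e).-1).
Proof.
move=> cf; apply: (@cmp_ext _ _ (fun e => iteri (f e) (fun k _ => k) 0)).
  by move=> e; case: (f e).
by apply: cmp_iteri; cmp.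
Qed.

Lemma cmp_if (E U : encType) (b : E -> bool) (u v : E -> U) :
  cmp b -> cmp u -> cmp v -> cmp (fun e => if b e then u e else v e).
Proof.
move=> cb cu cv.
apply: (@cmp_ext _ _ (fun e => iteri (enc (b e)) (fun _ _ => u e) (v e))).
  by move=> e; case: (b e).
by apply: (cmp_iteri (f := fun e _ _ => u e) (cmp_enc cb) cv); cmp.
Qed.

Lemma cmp_addn (E : encType) (f g : E -> nat) :
  cmp f -> cmp g -> cmp (fun e => f e + g e).
Proof.
move=> cf cg; apply: (@cmp_ext _ _ (fun e => iter (f e) succn (g e))).
  by move=> e; rewrite iter_succn addnC.
by apply: (cmp_iter (h := fun=> succn)); cmp.
Qed.

Lemma cmp_subn (E : encType) (f g : E -> nat) :
  cmp f -> cmp g -> cmp (fun e => f e - g e).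
Proof.
move=> cf cg; apply: (@cmp_ext _ _ (fun e => iter (g e) predn (f e))).
  by move=> e; elim: (g e) => [|k IH] /=; rewrite ?subn0 // IH subnS.
by apply: (cmp_iter (h := fun=> predn)) => //; apply: cmp_pred; cmp.
Qed.

Lemma cmp_nat_case (E U : encType) (n : E -> nat) (u : E -> U) (v : E ->
  nat -> U) :
  cmp n -> cmp u -> cmp (fun p : E * nat => v p.1 p.2) ->
  cmp (fun e => if n e is k.+1 then v e k else u e).
Proof.
move=> cn cu cv.
apply: (@cmp_ext _ _ (fun e => iteri (n e) (fun k _ => v e k) (u e))).
  by move=> e; case: (n e).
by apply: (cmp_iteri (f := fun e k _ => v e k)); cmp.
Qed.

Lemma cmp_eq0 (E : encType) (f : E -> nat) : cmp f -> cmp (fun e => f e == 0).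
Proof.
move=> cf; apply: (@cmp_ext _ _ (fun e => if f e is k.+1 then false else true)).
  by move=> e; case: (f e).
by apply: cmp_nat_case; cmp.
Qed.

Lemma cmp_andb (E : encType) (a b : E -> bool) :
  cmp a -> cmp b -> cmp (fun e => a e && b e).
Proof. by move=> ca cb; apply: cmp_if; cmp. Qed.

Lemma cmp_orb (E : encType) (a b : E -> bool) :
  cmp a -> cmp b -> cmp (fun e => a e || b e).
Proof. by move=> ca cb; apply: cmp_if; cmp. Qed.

Lemma cmp_negb (E : encType) (a : E -> bool) : cmp a -> cmp (fun e => ~~ a e).
Proof. by move=> ca; apply: cmp_if; cmp. Qed.

Lemma cmp_leq (E : encType) (f g : E -> nat) :
  cmp f -> cmp g -> cmp (fun e => f e <= g e).
Proof. by move=> cf cg; apply/cmp_eq0/cmp_subn. Qed.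

Lemma cmp_eqn (E : encType) (f g : E -> nat) :
  cmp f -> cmp g -> cmp (fun e => f e == g e).
Proof.
move=> cf cg; apply: (@cmp_ext _ _ (fun e => (f e <= g e) && (g e <= f e))).
  by move=> e; rewrite eqn_leq.
by apply: cmp_andb; apply: cmp_leq.
Qed.

Lemma cmp_eq_enc (E T : encType) (T' : eqType) (i : T' -> T) (f g : E -> T') :
  injective i -> cmp (fun e => i (f e)) -> cmp (fun e => i (g e)) ->
  cmp (fun e => f e == g e).
Proof.
move=> i_inj cf cg.
apply: (@cmp_ext _ _ (fun e => enc (i (f e)) == enc (i (g e)))).
  by move=> e; apply: (inj_eq (f := enc \o i)); apply: inj_comp i_inj;
    apply: enc_inj.
by apply: cmp_eqn; [apply: (cmp_enc cf)|apply: (cmp_enc cg)].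
Qed.

Lemma cmp_muln (E : encType) (f g : E -> nat) :
  cmp f -> cmp g -> cmp (fun e => f e * g e).
Proof.
move=> cf cg; apply: (@cmp_ext _ _ (fun e => iter (f e) (addn (g e)) 0)).
  by move=> e; rewrite iter_addn_0 mulnC.
by apply: (cmp_iter (h := fun e => addn (g e))); cmp; apply: cmp_addn; cmp.
Qed.

Lemma cmp_expn (E : encType) (f g : E -> nat) :
  cmp f -> cmp g -> cmp (fun e => f e ^ g e).
Proof.
move=> cf cg; apply: (@cmp_ext _ _ (fun e => iter (g e) (muln (f e)) 1)).
  by move=> e; rewrite iter_muln_1.
by apply: (cmp_iter (h := fun e => muln (f e))); cmp; apply: cmp_muln; cmp.
Qed.

Ltac cmp_arith ::=
  match goal with
  | |- cmp (fun x => enc _) => apply: cmp_enc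
  | |- cmp (fun x => iter _ _ _) => apply: cmp_iter
  | |- cmp (fun x => (_).-1) => apply: cmp_pred
  | |- cmp (fun x => _ && _) => apply: cmp_andb
  | |- cmp (fun x => _ || _) => apply: cmp_orb
  | |- cmp (fun x => ~~ _) => apply: cmp_negb
  | |- cmp (fun x => if _ then _ else _) => apply: cmp_if
  | |- cmp (fun x => _ + _) => apply: cmp_addn
  | |- cmp (fun x => _ - _) => apply: cmp_subn
  | |- cmp (fun x => _ * _) => apply: cmp_muln
  | |- cmp (fun x => _ ^ _) => apply: cmp_expn
  | |- cmp (fun x => _ <= _) => apply: cmp_leq
  | |- cmp (fun x => _ == _) => apply: cmp_eqn
  end.

(** Recursion on lists is reduced to bounded iteration on pairs of an accumulator and the unread
    part. Surplus passes change nothing, so any bound on the size will do; [leq_size_enc] supplies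
    the code of the list. *)
Lemma iter_foldl (T V : Type) (f : V -> T -> V) n s z : size s <= n ->
  iter n (fun st => if st.2 is x :: r then (f st.1 x, r) else st) (z, s) =
  (foldl f z s, [::]).
Proof.
by elim: n s z => [|n IH] [|x s] z // sn; rewrite iterSr IH.
Qed.

Definition take_step (T : Type) (st : seq T * seq T) :=
  if st.2 is x :: r then (rcons st.1 x, r) else st.

Lemma iter_take_drop (T : Type) n (a s : seq T) :
  iter n (@take_step T) (a, s) = (a ++ take n s, drop n s).
Proof.
elim: n a s => [|n IH] a s; first by rewrite take0 drop0 cats0.
rewrite iterSr; case: s => [|x s] /=; first by rewrite IH; case: n {IH}.
by rewrite IH cat_rcons.
Qed.

Lemma leq_size_enc (T : encType) (s : seq T) : size s <= enc s.
Proof.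
elim: s => //= x s IH; rewrite ltnS (leq_trans IH) //.
by apply: leq_trans (leq_npair _ _); apply: leq_addl.
Qed.

Lemma cmp_cons (E T : encType) (x : E -> T) (s : E -> seq T) :
  cmp x -> cmp s -> cmp (fun e => x e :: s e).
Proof.
by move=> cx cs; apply: (cmp_succ (f := fun e =>
  npair (enc (x e)) (enc (s e)))); apply: cmp_npair.
Qed.

(** The empty list has code 0 and a nonempty one the successor of a pair, so this is a case split on
    the code as a number. *)
Lemma cmp_seq_case (E T U : encType) (s : E -> seq T) (u : E -> U) (v : E ->
  T -> seq T -> U) :
  cmp s -> cmp u -> cmp (fun p : E * (T * seq T) => v p.1 p.2.1 p.2.2) ->
  cmp (fun e => if s e is x :: r then v e x r else u e).
Proof.
move=> [s' cs ss'] [u' cu uu'] [v' cv vv'].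
have : cmp (fun n => if s' n is k.+1 then v' (npair n k) else u' n).
  have cu' : cmp u' by exists u'.
  have cs' : cmp s' by exists s'.
  have cv' : cmp v' by exists v'.
  by apply: (cmp_nat_case (v := fun n k => v' (npair n k))); cmp.
move=> [h ch hh]; exists h => // e.
have := hh (enc e); rewrite /= ss' uu'; case: (s e) => //= x r ->.
exact: (vv' (e, (x, r))).
Qed.

Lemma cmp_foldl (E T U : encType) (f : E -> U -> T -> U) (z : E -> U) (s :
  E -> seq T) :
  cmp (fun p : E * (U * T) => f p.1 p.2.1 p.2.2) -> cmp z -> cmp s ->
  cmp (fun e => foldl (f e) (z e) (s e)).
Proof.
move=> cf cz cs; apply: (@cmp_ext _ _ (fun e => (iter (enc (s e))
    (fun st => if st.2 is x :: r then (f e st.1 x, r) else st) (z e, s e)).1)).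
  by move=> e; rewrite iter_foldl ?leq_size_enc.
by cmp; apply: (cmp_seq_case (v := fun p x r => (f p.1 p.2.1 x, r))); cmp.
Qed.

Lemma cmp_rev (E T : encType) (s : E -> seq T) :
  cmp s -> cmp (fun e => rev (s e)).
Proof.
move=> cs.
apply: (@cmp_ext _ _ (fun e => foldl (fun r x => x :: r) [::] (s e))).
  by move=> e; rewrite /rev; elim: (s e) [::] => /=.
by apply: (cmp_foldl (f := fun _ r x => x :: r)); cmp; apply: cmp_cons; cmp.
Qed.

Lemma cmp_foldr (E T U : encType) (f : E -> T -> U -> U) (z : E -> U) (s :
  E -> seq T) :
  cmp (fun p : E * (T * U) => f p.1 p.2.1 p.2.2) -> cmp z -> cmp s ->
  cmp (fun e => foldr (f e) (z e) (s e)).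
Proof.
move=> cf cz cs.
apply: (@cmp_ext _ _ (fun e => foldl (fun y x => f e x y) (z e) (rev (s e)))).
  by move=> e; rewrite foldl_rev.
by apply: (cmp_foldl (f := fun e y x => f e x y)); cmp; apply: cmp_rev.
Qed.

Lemma cmp_cat (E T : encType) (s r : E -> seq T) :
  cmp s -> cmp r -> cmp (fun e => s e ++ r e).
Proof.
move=> cs cr; apply: (@cmp_ext _ _ (fun e => foldr cons (r e) (s e))).
  by move=> e; elim: (s e) => //= x l ->.
by apply: (cmp_foldr (f := fun _ => cons)); cmp; apply: cmp_cons; cmp.
Qed.

Lemma cmp_map (E T U : encType) (f : E -> T -> U) (s : E -> seq T) :
  cmp (fun p : E * T => f p.1 p.2) -> cmp s -> cmp (fun e => map (f e) (s e)).
Proof.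
move=> cf cs.
apply: (@cmp_ext _ _ (fun e => foldr (fun x l => f e x :: l) [::] (s e))).
  by move=> e; elim: (s e) => //= x l ->.
by apply: (cmp_foldr (f := fun e x l => f e x :: l)); cmp; apply: cmp_cons; cmp.
Qed.

Lemma cmp_filter (E T : encType) (a : E -> T -> bool) (s : E -> seq T) :
  cmp (fun p : E * T => a p.1 p.2) -> cmp s ->
  cmp (fun e => seq.filter (a e) (s e)).
Proof.
move=> ca cs; apply: (@cmp_ext _ _
    (fun e => foldr (fun x l => if a e x then x :: l else l) [::] (s e))).
  by move=> e; elim: (s e) => //= x l ->.
apply: (cmp_foldr (f := fun e x l => if a e x then x :: l else l)); cmp.
by apply: cmp_cons; cmp.
Qed.

Lemma cmp_has (E T : encType) (a : E -> T -> bool) (s : E -> seq T) :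
  cmp (fun p : E * T => a p.1 p.2) -> cmp s -> cmp (fun e => has (a e) (s e)).
Proof.
move=> ca cs.
apply: (@cmp_ext _ _ (fun e => foldr (fun x b => a e x || b) false (s e))).
  by move=> e; elim: (s e) => //= x l ->.
by apply: (cmp_foldr (f := fun e x b => a e x || b)); cmp.
Qed.

Lemma cmp_size (E T : encType) (s : E -> seq T) :
  cmp s -> cmp (fun e => size (s e)).
Proof.
move=> cs; apply: (@cmp_ext _ _ (fun e => foldr (fun=> succn) 0 (s e))).
  by move=> e; elim: (s e) => //= x l ->.
by apply: (cmp_foldr (f := fun _ _ => succn)); cmp.
Qed.

Lemma cmp_head (E T : encType) (x : E -> T) (s : E -> seq T) :
  cmp x -> cmp s -> cmp (fun e => head (x e) (s e)).
Proof. by move=> cx cs; apply: (cmp_seq_case (v := fun _ x _ => x)); cmp. Qed.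

Lemma cmp_find (E T : encType) (a : E -> T -> bool) (s : E -> seq T) :
  cmp (fun p : E * T => a p.1 p.2) -> cmp s -> cmp (fun e => find (a e) (s e)).
Proof.
move=> ca cs; apply: (@cmp_ext _ _
    (fun e => foldr (fun x n => if a e x then 0 else n.+1) 0 (s e))).
  by move=> e; elim: (s e) => //= x l ->.
by apply: (cmp_foldr (f := fun e x n => if a e x then 0 else n.+1)); cmp.
Qed.

Lemma cmp_rcons (E T : encType) (s : E -> seq T) (x : E -> T) :
  cmp s -> cmp x -> cmp (fun e => rcons (s e) (x e)).
Proof.
move=> cs cx; apply: (@cmp_ext _ _ (fun e => s e ++ [:: x e])).
  by move=> e; rewrite cats1.
by apply: cmp_cat => //; apply: cmp_cons; cmp.
Qed.

Lemma cmp_count (E T : encType) (a : E -> T -> bool) (s : E -> seq T) :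
  cmp (fun p : E * T => a p.1 p.2) -> cmp s -> cmp (fun e => count (a e) (s e)).
Proof.
move=> ca cs; apply: (@cmp_ext _ _ (fun e => size (seq.filter (a e) (s e)))).
  by move=> e; rewrite size_filter.
by apply/cmp_size/cmp_filter.
Qed.

Lemma cmp_flatten (E T : encType) (s : E -> seq (seq T)) :
  cmp s -> cmp (fun e => flatten (s e)).
Proof.
by move=> cs; apply: (cmp_foldr (f := fun _ => cat)); cmp; apply: cmp_cat; cmp.
Qed.

Lemma cmp_take_step (T : encType) : cmp (@take_step T).
Proof.
apply: (cmp_seq_case (v := fun st x r => (rcons st.1 x, r))); cmp.
by apply: cmp_rcons; cmp.
Qed.

Lemma cmp_take (E T : encType) (n : E -> nat) (s : E -> seq T) :
  cmp n -> cmp s -> cmp (fun e => take (n e) (s e)).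
Proof.
move=> cn cs; have cT := cmp_take_step T.
apply: (@cmp_ext _ _ (fun e => (iter (n e) (@take_step T) ([::], s e)).1)).
  by move=> e; rewrite iter_take_drop.
by cmp.
Qed.

Lemma cmp_drop (E T : encType) (n : E -> nat) (s : E -> seq T) :
  cmp n -> cmp s -> cmp (fun e => drop (n e) (s e)).
Proof.
move=> cn cs; have cT := cmp_take_step T.
apply: (@cmp_ext _ _ (fun e => (iter (n e) (@take_step T) ([::], s e)).2)).
  by move=> e; rewrite iter_take_drop.
by cmp.
Qed.

Lemma cmp_nth (E T : encType) (x : E -> T) (s : E -> seq T) (n : E -> nat) :
  cmp x -> cmp s -> cmp n -> cmp (fun e => nth (x e) (s e) (n e)).
Proof.
move=> cx cs cn; apply: (@cmp_ext _ _ (fun e => head (x e) (drop (n e) (s e)))).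
  by move=> e; rewrite -nth0 nth_drop addn0.
by apply: cmp_head => //; apply: cmp_drop.
Qed.

Lemma cmp_iota (E : encType) (n : E -> nat) :
  cmp n -> cmp (fun e => iota 0 (n e)).
Proof.
move=> cn.
apply: (@cmp_ext _ _ (fun e => iteri (n e) (fun k l => rcons l k) [::])).
  by move=> e; elim: (n e) => // k IH; rewrite -addn1 iotaD addn1 /= cats1 IH.
by apply: (cmp_iteri (f := fun _ k l => rcons l k)); cmp; apply: cmp_rcons; cmp.
Qed.

Lemma cmp_eq_bits (E : encType) (s r : E -> seq bool) :
  cmp s -> cmp r -> cmp (fun e => s e == r e).
Proof.
by move=> cs cr; apply: (@cmp_eq_enc _ (seq_encType bool_encType) _ id).
Qed.

Lemma cmp_mem_bits (E : encType) (s : E -> seq bool) (r : E -> seq (seq bool)) :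
  cmp s -> cmp r -> cmp (fun e => s e \in r e).
Proof.
move=> cs cr; apply: (@cmp_ext _ _ (fun e => has (fun x => s e == x) (r e))).
  by move=> e; rewrite -has_pred1; apply: eq_has => x; rewrite /= eq_sym.
by apply: (cmp_has (a := fun e x => s e == x)); cmp; apply: cmp_eq_bits; cmp.
Qed.

Ltac cmp_list ::=
  match goal with
  | |- cmp (fun x => _ == _) => apply: cmp_eq_bits
  | |- cmp (fun x => _ \in _) => apply: cmp_mem_bits
  | |- cmp (fun x => _ :: _) => apply: cmp_cons
  | |- cmp (fun x => rcons _ _) => apply: cmp_rcons
  | |- cmp (fun x => _ ++ _) => apply: cmp_cat
  | |- cmp (fun x => foldr _ _ _) => apply: cmp_foldr
  | |- cmp (fun x => map _ _) => apply: cmp_map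
  | |- cmp (fun x => seq.filter _ _) => apply: cmp_filter
  | |- cmp (fun x => has _ _) => apply: cmp_has
  | |- cmp (fun x => find _ _) => apply: cmp_find
  | |- cmp (fun x => count _ _) => apply: cmp_count
  | |- cmp (fun x => head _ _) => apply: cmp_head
  | |- cmp (fun x => size _) => apply: cmp_size
  | |- cmp (fun x => flatten _) => apply: cmp_flatten
  | |- cmp (fun x => take _ _) => apply: cmp_take
  | |- cmp (fun x => drop _ _) => apply: cmp_drop
  | |- cmp (fun x => nth _ _ _) => apply: cmp_nth
  | |- cmp (fun x => iota 0 _) => apply: cmp_iota
  end.

(** * A universal machine *)

(* A state is a stack of pending instructions together with the value computed
   last. An instruction is a tag, the code of a program and the saved data. *)
Definition instr : Type := (nat * nat * nat * nat * nat)%type.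
Definition state : Type := (seq instr * nat)%type.

Definition run (c : nat) : instr := (0, c, 0, 0, 0).
Definition check (c : nat) : instr := (1, c, 0, 0, 0).
(** The other four instructions wait for the value of a subcomputation: [pair_left] and [pair_right]
    for the first and second component, [prec_loop] for the value of the recursion at [i], [mu_loop]
    for the value of the tested program at [(x, i)]. *)
Definition pair_left (c x : nat) : instr := (2, c, x, 0, 0).
Definition pair_right (u : nat) : instr := (3, u, 0, 0, 0).
Definition prec_loop (c a i n : nat) : instr := (4, c, a, i, n).
Definition mu_loop (c x i : nat) : instr := (5, c, x, i, 0).

(* An instruction that cannot be executed, such as a query beyond the end of the
   oracle string, is put back, so that the stack is never emptied. *)
Definition run_step (s : seq bool) (c x : nat) (K : seq instr) : state :=
  if nfst c == 0 then (K, 0)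
  else if nfst c == 1 then (K, x.+1)
  else if nfst c == 2 then (K, nfst x)
  else if nfst c == 3 then (K, nsnd x)
  else if nfst c == 4 then
    if x < size s then (K, enc (nth false s x)) else (run c :: K, x)
  else if nfst c == 5 then
    (run (nfst (nsnd c)) :: pair_left (nsnd (nsnd c)) x :: K, x)
  else if nfst c == 6 then
    (run (nsnd (nsnd c)) :: run (nfst (nsnd c)) :: K, x)
  else if nfst c == 7 then
    (run (nfst (nsnd c)) :: prec_loop (nsnd (nsnd c)) (nfst x) 0 (nsnd x) :: K,
     nfst x)
  else if nfst c == 8 then
    (run (nsnd c) :: mu_loop (nsnd c) x 0 :: K, npair x 0)
  else (run c :: K, x).

(* The machine would also run some numbers that are not codes of programs, which
   the jump excludes; hence the preliminary check. *)
Definition check_step (c x : nat) (K : seq instr) : state :=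
  if nfst c < 5 then if nsnd c == 0 then (K, x) else (check c :: K, x)
  else if nfst c < 8 then
    (check (nfst (nsnd c)) :: check (nsnd (nsnd c)) :: K, x)
  else if nfst c == 8 then (check (nsnd c) :: K, x)
  else (check c :: K, x).

Definition instr_step (s : seq bool) (ins : instr) (x : nat) (K : seq instr) :
    state :=
  let: (k, c, a, i, n) := ins in
  if k == 0 then run_step s c x K
  else if k == 1 then check_step c x K
  else if k == 2 then (run c :: pair_right x :: K, a)
  else if k == 3 then (K, npair c x)
  else if k == 4 then
    if i == n then (K, x)
    else (run c :: prec_loop c a i.+1 n :: K, npair a (npair i x))
  else
    if x == 0 then (K, i)
    else (run c :: mu_loop c a i.+1 :: K, npair a i.+1).

Definition step (s : seq bool) (st : state) : state :=
  if st.1 is ins :: K then instr_step s ins st.2 K else st.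

Lemma step_cons s ins K x : step s (ins :: K, x) = instr_step s ins x K.
Proof. by []. Qed.

(* The length of the oracle string also serves as time bound. *)
Definition halts_within (s : seq bool) (e : nat) : bool :=
  size (iter (size s) (step s) ([:: check e; run e], e)).1 == 0.

Lemma cmp_halts_within (E : encType) (s : E -> seq bool) (e : E -> nat) :
  cmp s -> cmp e -> cmp (fun x => halts_within (s x) (e x)).
Proof.
move=> cs ce; rewrite /halts_within /step /check /run; cmp.
apply: (@cmp_seq_case _ _ _ (fun p => p.2.1) (fun p => p.2)
  (fun p ins K => instr_step (s p.1) ins p.2.2 K)); cmp.
(* Projections replace the pattern matching on the instruction, which [cmp] does not treat. *)
apply: (@cmp_ext _ _ (fun p => instr_step (s p.1.1)
   (p.2.1.1.1.1.1, p.2.1.1.1.1.2, p.2.1.1.1.2, p.2.1.1.2, p.2.1.2)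
   p.1.2.2 p.2.2)).
  by case=> [[? ?] [[[[[? ?] ?] ?] ?] ?]].
rewrite /instr_step /run_step /check_step /run /check /pair_left /pair_right.
by rewrite /prec_loop /mu_loop; cmp.
Qed.

Section Machine.
Variables (X : set nat).

Lemma size_restr m : size (restr X m) = m.
Proof. by rewrite size_map size_iota. Qed.

Lemma nth_restr m i : i < m -> nth false (restr X m) i = `[< X i >].
Proof. by move=> im; rewrite (nth_map 0) ?size_iota // nth_iota // add0n. Qed.

Lemma take_restr m k : take m (restr X k) = restr X (minn m k).
Proof. by rewrite -map_take take_iota. Qed.

Lemma peval_prec0 p q a y : peval X (Prec p q) (npair a 0) y <-> peval X p a y.
Proof. by rewrite /= nsndK nfstK. Qed.

Lemma peval_precS p q a n y : peval X (Prec p q) (npair a n.+1) y <->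
  exists2 u, peval X (Prec p q) (npair a n) u &
             peval X q (npair a (npair n u)) y.
Proof. by rewrite /= !nsndK !nfstK. Qed.

Definition stops s k (st : state) := (iter k (step s) st).1 = [::].

Lemma stops_cons s k ins K x : stops s k (ins :: K, x) ->
  exists2 k', k = k'.+1 & stops s k' (instr_step s ins x K).
Proof. by case: k => // k; rewrite /stops iterSr => H; exists k. Qed.

Lemma stuck s ins x K k : instr_step s ins x K = (ins :: K, x) ->
  ~ stops s k (ins :: K, x).
Proof.
move=> e; elim: k => // k IH; apply: contra_not IH.
by rewrite /stops iterSr step_cons e.
Qed.

(** The induction is on the number of steps, since [c] is not yet known to be the code of a program;
    malformed numbers are caught by [stuck]. *)
Lemma check_sound s k c K x : stops s k (check c :: K, x) ->
  exists2 p, prog_code p = c & exists2 k', k' < k & stops s k' (K, x).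
Proof.
elim/ltn_ind: k c K => k IH c K H.
have [k1 kk1 H1] := stops_cons H; subst k.
move: H1; rewrite /= /check_step.
have [lt5|ge5] := ltnP (nfst c) 5.
  have [d0 H1|d0] := eqVneq (nsnd c) 0; last first.
    move=> H1; exfalso; apply: stuck H.
    by rewrite /= /check_step lt5 (negbTE d0).
  exists (nth Zero [:: Zero; Succ; Fst; Snd; Oracle] (nfst c)); last first.
    by exists k1.
  rewrite -[RHS](npairK c) d0.
  by move: (nfst c) lt5 => [|[|[|[|[|]]]]].
have [lt8|ge8] := ltnP (nfst c) 8.
  move=> /IH[|p pc [k2 k21 /IH[|q qc [k3 k32 H3]]]]; [lia|lia|].
  exists (if nfst c == 5 then Pair p q else if nfst c == 6 then Comp p q
          else Prec p q).
    rewrite -[RHS](npairK c) -[nsnd c](npairK) -pc -qc.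
    by move: (nfst c) lt8 ge5 => [|[|[|[|[|[|[|[|]]]]]]]].
  by exists k3 => //; lia.
have [t8|t8] := eqVneq (nfst c) 8; last first.
  move=> H1; exfalso; apply: stuck H.
  by rewrite /= /check_step ltnNge ge5 ltnNge ge8 (negbTE t8).
move=> /IH[|p pc [k2 k21 H2]]; first by lia.
exists (Mu p); first by rewrite -[RHS](npairK c) t8 -pc.
by exists k2 => //; lia.
Qed.

(** The stack [K] is arbitrary so that the induction hypotheses apply to subprograms with
    instructions pending, and [k' < k] allows an induction on steps for the unbounded search of
    [Mu]. *)
Lemma run_sound m p k K x : stops (restr X m) k (run (prog_code p) :: K, x) ->
  exists2 y, peval X p x y & exists2 k', k' < k & stops (restr X m) k' (K, y).
Proof.
elim: p k K x => [||||||||]; only 1-5: move=> k K x H.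
1-4: by move/stops_cons: (H) => [k1 ->] /=; rewrite /run_step nfstK /= => H1;
  eexists; first reflexivity; exists k1.
- have := stops_cons H => -[k1 -> /=]; rewrite /run_step nfstK /= size_restr.
  case: ltnP => [xm|mx] H1.
    by eexists; first reflexivity; exists k1 => //; rewrite -(nth_restr xm).
  exfalso; apply: stuck H.
  by rewrite /= /run_step nfstK /= size_restr ltnNge mx.
- move=> p IHp q IHq k K x /stops_cons[k1 ->]; rewrite [instr_step _ _ _ _]/=.
  rewrite /run_step !(nfstK, nsndK) /= =>
    /IHp[u pu [k2 k21 /stops_cons[k3 k23]]].
  move=> /IHq[v qv [k4 k43 /stops_cons[k5 k45 H]]].
  exists (npair u v); first by exists u, v.
  by exists k5 => //; lia.
- move=> p IHp q IHq k K x /stops_cons[k1 ->]; rewrite [instr_step _ _ _ _]/=.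
  rewrite /run_step !(nfstK, nsndK) /= => /IHq[u qu [k2 k21]].
  move=> /IHp[v pv [k3 k32 H]].
  by exists v; [exists u|exists k3 => //; lia].
- move=> p IHp q IHq k K x.
  have loop d a i k' K' u : peval X (Prec p q) (npair a i) u ->
      stops (restr X m) k' (prec_loop (prog_code q) a i (i + d) :: K', u) ->
    exists2 y, peval X (Prec p q) (npair a (i + d)) y &
      exists2 k'', k'' < k' & stops (restr X m) k'' (K', y).
    elim: d i k' u => [|d IHd] i k' u pu /stops_cons[k1 ->] /=.
      by rewrite addn0 eqxx => H; exists u => //; exists k1.
    have -> : (i == i + d.+1) = false by lia.
    move=> /IHq[v qv [k2 k21]].
    rewrite -addSnnS => /IHd[|y py [k3 k32 H]]; first by apply/peval_precS;
      exists u.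
    by exists y => //; exists k3 => //; lia.
  move/stops_cons=> [k1 ->]; rewrite [instr_step _ _ _ _]/= /run_step.
  rewrite !(nfstK, nsndK) [7 == _]/= => /IHp[u pu [k2 k21]].
  move=> /(loop (nsnd x))[|y]; first exact/peval_prec0.
  rewrite add0n npairK => py [k3 k32 H].
  by exists y => //; exists k3 => //; lia.
- move=> p IHp k K x.
  (* Loop invariant: [r] is the value at candidate [i], and all earlier candidates gave nonzero
     values. *)
  have loop i r k' K' : peval X p (npair x i) r ->
      (forall j, j < i -> exists r', peval X p (npair x j) r'.+1) ->
      stops (restr X m) k' (mu_loop (prog_code p) x i :: K', r) ->
    exists2 y, peval X (Mu p) x y &
      exists2 k'', k'' < k' & stops (restr X m) k'' (K', y).
    elim/ltn_ind: k' i r => k' IHk i r pr lti /stops_cons[k1 kk1] /=.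
    case: r pr => [|r] pr /=; first by move=> H; exists i; rewrite ?kk1 //;
      exists k1.
    move=> /IHp[r' pr' [k2 k21]] /IHk[|//||y py [k3 k32 H]]; first by lia.
      by move=> j; rewrite ltnS leq_eqVlt => /predU1P[->|/lti//]; exists r.
    by exists y => //; exists k3 => //; lia.
  move/stops_cons=> [k1 ->]; rewrite [instr_step _ _ _ _]/= /run_step.
  rewrite !(nfstK, nsndK) [8 == _]/= => /IHp[r pr [k2 k21]].
  by move/(loop _ _ _ _ pr) => [//|y py [k3 k32 H]]; exists y => //;
    exists k3 => //; lia.
Qed.

(** The step count is the same for all long enough prefixes of [X] and all [K]. Hence runs can be
    concatenated, and the prefix can still be lengthened to provide enough time. *)
Definition reaches (J : seq instr) (x y : nat) := exists m0 k, forall m K,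
  m0 <= m -> iter k (step (restr X m)) (J ++ K, x) = (K, y).

Lemma reaches_nil x : reaches [::] x x. Proof. by exists 0, 0. Qed.

Lemma reaches_cat J J' x y z : reaches J x y -> reaches J' y z ->
  reaches (J ++ J') x z.
Proof.
move=> [m1 [k1 H1]] [m2 [k2 H2]]; exists (maxn m1 m2), (k2 + k1) => m K.
by rewrite geq_max => /andP[m1m m2m]; rewrite iterD -catA H1 ?H2.
Qed.

Lemma reaches_step ins J x x' y :
  (forall s K, instr_step s ins x K = (J ++ K, x')) ->
  reaches J x' y -> reaches [:: ins] x y.
Proof.
move=> e [m0 [k H]]; exists m0, k.+1 => m K mm.
by rewrite iterSr step_cons e H.
Qed.

Lemma check_complete p x : reaches [:: check (prog_code p)] x x.
Proof.
have leaf n : n < 5 -> reaches [:: check (npair n 0)] x x.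
  move=> n5; apply: reaches_step (reaches_nil x) => s K.
  by rewrite /= /check_step nfstK nsndK n5.
elim: p => [||||||||]; do 5?exact: leaf; only 1-3: move=> p IHp q IHq.
1-3: apply: reaches_step (reaches_cat IHp IHq) => s K;
  by rewrite /= /check_step !(nfstK, nsndK).
move=> p IHp; apply: reaches_step IHp => s K.
by rewrite /= /check_step !(nfstK, nsndK).
Qed.

Lemma run_complete p x y : peval X p x y -> reaches [:: run (prog_code p)] x y.
Proof.
elim: p x y => [||||||||].
1-4: move=> x y ->; apply: reaches_step (reaches_nil _) => s K;
  by rewrite /= /run_step !(nfstK, nsndK).
- move=> x y ->; exists x.+1, 1 => m K xm.
  by rewrite /= step_cons /= /run_step nfstK /= size_restr xm nth_restr.
- move=> p IHp q IHq x y [u [v [/IHp pu /IHq qv ->]]].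
  apply: (@reaches_step _
    ([:: run (prog_code p)] ++ [:: pair_left (prog_code q) x]) _ x).
    by move=> s K; rewrite /= /run_step !(nfstK, nsndK).
  apply: reaches_cat pu _.
  apply: (@reaches_step _
    ([:: run (prog_code q)] ++ [:: pair_right u]) _ x) => //.
  by apply: reaches_cat qv _; apply: reaches_step (reaches_nil _).
- move=> p IHp q IHq x y [u /IHq qu /IHp pu].
  by apply: reaches_step (reaches_cat qu pu) => s K;
    rewrite /= /run_step !(nfstK, nsndK).
- move=> p IHp q IHq x y.
  (* By induction on the [n] passes already made, a run of the loop from index [n] is extended
     backwards to one from the start. *)
  have loop a n N u v : peval X (Prec p q) (npair a n) u -> n <= N ->
      reaches [:: prec_loop (prog_code q) a n N] u v ->
      reaches [:: run (prog_code p); prec_loop (prog_code q) a 0 N] a v.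
    elim: n u => [|n IHn] u; first by move=> /peval_prec0/IHp pu _;
      apply: reaches_cat pu.
    move=> /peval_precS[w pw /IHq qu] nN H; apply: IHn pw (ltnW nN) _.
    by apply: reaches_step (reaches_cat qu H) => s K; rewrite /= ltn_eqF.
  rewrite -[x in peval _ _ x]npairK => /loop/(_ (leqnn _)) H.
  have /H{}H :
      reaches [:: prec_loop (prog_code q) (nfst x) (nsnd x) (nsnd x)] y y.
    by apply: reaches_step (reaches_nil _) => s K; rewrite /= eqxx.
  by apply: reaches_step H => s K; rewrite /= /run_step !(nfstK, nsndK).
- move=> p IHp x y [py lty].
  have loop d i r : i + d = y -> peval X p (npair x i) r ->
      reaches [:: mu_loop (prog_code p) x i] r y.
    elim: d i r => [|d IHd] i r.
      rewrite addn0 => -> /peval_fun/(_ py) ->.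
      by apply: reaches_step (reaches_nil _).
    move=> iy; have /lty[r' pr' /peval_fun/(_ pr') ->] : i < y by lia.
    have [r'' pr''] : exists r'', peval X p (npair x i.+1) r''.
      have : i.+1 <= y by lia.
      by rewrite leq_eqVlt => /predU1P[->|/lty[k pk]]; [exists 0|exists k.+1].
    apply: reaches_step (reaches_cat (IHp _ _ pr'') (IHd i.+1 _ _ pr'')) => //.
    by lia.
  have [r pr] : exists r, peval X p (npair x 0) r.
    by case: (posnP y) py lty => [->|y0] py lty;
      [exists 0|have [k] := lty 0 y0; exists k.+1].
  apply: reaches_step (reaches_cat (IHp _ _ pr) (loop y 0 _ _ pr)) => // s K.
  by rewrite /= /run_step !(nfstK, nsndK).
Qed.

Lemma stops_ge s k k' st : k <= k' -> stops s k st -> stops s k' st.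
Proof.
move=> /subnK <-; rewrite /stops iterD; case: (iter k _ st) => [K x] /= ->.
by elim: (k' - k) => //= n; case: (iter n _ _) => [L y] /= ->.
Qed.

Lemma jump_halts_within e : jump X e <-> exists m, halts_within (restr X m) e.
Proof.
split=> [[p <- [y py]]|[m]].
  have [m0 [k H]] :=
    reaches_cat (check_complete p (prog_code p)) (run_complete py).
  (* The prefix has to answer all queries ([m0]) and, being the time bound as well, to allow [k]
     steps. *)
  exists (maxn m0 k); rewrite /halts_within size_restr size_eq0; apply/eqP.
  apply: (@stops_ge _ k); first exact: leq_maxr.
  by have /= := H (maxn m0 k) [::] (leq_maxl _ _); rewrite /stops => ->.
rewrite /halts_within size_eq0 => /eqP/check_sound[p pe [k _]].
by rewrite -pe => /run_sound[y py _]; exists p => //; exists y.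
Qed.
End Machine.

(** Truncation matters only for a query at [m] or beyond, and on the truncated string such a query
    is stuck forever. *)
Lemma instr_step_take s m ins x K :
  instr_step (take m s) ins x K = instr_step s ins x K \/
  exists2 c, instr_step (take m s) ins x K = (run c :: K, x) &
             instr_step (take m s) (run c) x K = (run c :: K, x).
Proof.
case: ins => [[[[t c] a] i] n]; rewrite /= /run_step.
case: (t == 0); last by left.
have [c4|c4] := eqVneq (nfst c) 4; last by left.
rewrite !c4 /=; case: ltnP => xm; last by right; exists c; rewrite ?c4.
by move: xm; rewrite size_take_min leq_min => /andP[xm ->];
  rewrite nth_take //; left.
Qed.

Lemma stops_take s m k st : stops (take m s) k st -> stops s k st.
Proof.
elim: k st => [|k IH] [[|ins K] x]; [by []|by []| |].
  by move=> _; apply: (@stops_ge _ 0).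
rewrite /stops iterSr => H; rewrite iterSr; have := IH _ H;
  rewrite /stops !step_cons.
case: (instr_step_take s m ins x K) => [-> //|[c e1 e2]].
by move: H; rewrite step_cons e1 => /(stuck e2).
Qed.

(** A longer string answers more queries and allows more time. So halting defines an open class, and
    the approximations to X' only grow. *)
Lemma halts_within_take s m e : halts_within (take m s) e -> halts_within s e.
Proof.
rewrite /halts_within !size_eq0 => /eqP/stops_take H.
apply/eqP; apply: stops_ge H; rewrite size_take_min; exact: geq_minr.
Qed.

(** * Counting strings *)

Definition strings (m : nat) : seq (seq bool) :=
  iter m (fun L => map (cons true) L ++ map (cons false) L) [:: [::]].

Lemma mem_strings m r : (r \in strings m) = (size r == m).
Proof.
elim: m r => [|m IH] [|b r] //=; rewrite mem_cat ?eqSS.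
  by apply/norP; split; apply/mapP => -[].
rewrite -IH; case: b; rewrite ?(mem_map (can_inj (g := behead) _)) //=.
  by rewrite orbC orb_idl // => /mapP[].
by rewrite orb_idl // => /mapP[].
Qed.

Lemma uniq_strings m : uniq (strings m).
Proof.
elim: m => //= m IH; rewrite cat_uniq !map_inj_uniq ?IH ?andbT /=;
  try by move=> ? ? [].
by apply/hasPn => _ /mapP[r _ ->]; apply/mapP => -[].
Qed.

Lemma size_strings m : size (strings m) = 2 ^ m.
Proof.
by elim: m => //= m IH; rewrite size_cat !size_map IH expnS mul2n addnn.
Qed.

(** Each string of length [m] has [2 ^ d] extensions of length [m + d]. *)
Lemma sum_strings_take (w : seq bool -> nat) m d :
  \sum_(r <- strings (m + d)) w (take m r) = 2 ^ d * \sum_(r <- strings m) w r.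
Proof.
elim: m w => [|m IH] w.
  under eq_bigr do rewrite take0.
  by rewrite big_const_seq count_predT size_strings iter_addn_0 big_seq1 mulnC.
rewrite /= !big_cat /= !big_map /= mulnDr.
by rewrite (IH (fun r => w (true :: r))) (IH (fun r => w (false :: r))).
Qed.

Lemma sum_bool_count (T : Type) (p : pred T) s : \sum_(x <- s) (p x :
  nat) = count p s.
Proof. by elim: s => [|x s IH]; rewrite ?big_nil // big_cons IH. Qed.

Lemma count_strings_take (p : pred (seq bool)) m d :
  count (fun r => p (take m r)) (strings (m + d)) = 2 ^ d * count p (strings m).
Proof. by rewrite -!sum_bool_count; apply: sum_strings_take p m d. Qed.

(** Averaging: [G] splits the [2 ^ s] strings into [2 ^ n] fibres, which cannot all be larger than
    the mean. *)
Lemma strings_pigeonhole (G : seq bool -> seq bool) n s :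
  (forall r, size (G r) = n) ->
  exists2 sg, sg \in strings n &
    count (fun r => G r == sg) (strings s) * 2 ^ n <= 2 ^ s.
Proof.
move=> sG; apply/hasP; rewrite -[has _ _]negbK -all_predC;
  apply/negP => /allP H.
have : \sum_(sg <- strings n) count (fun r => G r == sg) (strings s) = 2 ^ s.
  under eq_bigr do rewrite -sum_bool_count.
  rewrite exchange_big /= -(size_strings s) -sum1_size.
  apply: eq_bigr => r _; rewrite sum_bool_count.
  under eq_count do rewrite eq_sym.
  rewrite -/(count_mem _ _) count_uniq_mem ?uniq_strings //.
  by rewrite mem_strings sG eqxx.
move=> sumE.
have : \sum_(sg <- strings n) (2 ^ s).+1 <=
    \sum_(sg <- strings n) count (fun r => G r == sg) (strings s) * 2 ^ n.
  rewrite !big_seq; apply: leq_sum => sg /H /=; by rewrite -ltnNge.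
rewrite -big_distrl /= sumE big_const_seq count_predT size_strings iter_addn_0.
by rewrite leq_pmul2r ?expn_gt0 // ltnn.
Qed.

(** * Stabilisation of increasing approximations *)

Section Stabilisation.
Variables (h : seq bool -> nat -> bool) (Q : seq nat).
Hypothesis h_take : forall r m q, h (take m r) q -> h r q.

(** By [h_take] answers only switch from false to true along a string, so this detects every change
    after stage [s]. *)
Definition changed (s : nat) (r : seq bool) : bool :=
  has (fun q => h r q && ~~ h (take s r) q) Q.

Let weight r := count (h r) Q.

Lemma changed_weight s r : changed s r + weight (take s r) <= weight r.
Proof.
rewrite /changed /weight.
elim: Q => //= q L IH.
case hq: (h (take s r) q); first by rewrite (h_take hq) /= addnCA leq_add2l.
rewrite andbT add0n; case: (h r q) => //=.
by rewrite leq_add2l (leq_trans _ IH) // leq_addl.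
Qed.

Lemma changed_small s r : size r <= s -> changed s r = false.
Proof. by move=> sr; apply/hasP => -[q _]; rewrite take_oversize // andbN. Qed.

Lemma changed_take s t r : changed s (take t r) -> changed s r.
Proof.
case: (leqP s t) => st; last first.
  by rewrite changed_small // size_take_min (leq_trans (geq_minl _ _)) // ltnW.
move=> /hasP[q qQ /andP[hq nhq]]; apply/hasP; exists q => //.
by move: nhq; rewrite (h_take hq) take_takel.
Qed.

(** The changes after stage [s] that are visible at length [t] have measure at most [2 ^ -n].
    Clearing denominators makes this a count of strings. *)
Definition stable (n s t : nat) : bool :=
  count (changed s) (strings t) * 2 ^ n <= 2 ^ t.

Lemma stable_small n s t : t <= s -> stable n s t.
Proof.
move=> ts; rewrite /stable (@eq_in_count _ _ pred0) ?count_pred0 // => r.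
by rewrite mem_strings => /eqP rt; rewrite changed_small // rt.
Qed.

(** Changes persist under extension, so instability once visible remains visible at all greater
    lengths. *)
Lemma stable_le n s t t' : t <= t' -> stable n s t' -> stable n s t.
Proof.
move=> /subnKC <-; rewrite /stable => H.
rewrite -(leq_pmul2l (expn_gt0 2 (t' - t))) -expnD [_ - _ + _]addnC.
apply: leq_trans H; rewrite mulnA leq_mul2r -count_strings_take.
apply/orP; right.
by apply: sub_count => r; apply: changed_take.
Qed.

(* The total weight at stage [t], divided by [2 ^ t], is nondecreasing in [t]
   and bounded by [size Q], while each failure of stability adds [2 ^ -n]. *)
Lemma eventually_stable n : exists s, forall t, stable n s t.
Proof.
apply: contrapT => /forallNP unst.
pose W t := \sum_(r <- strings t) weight r.
have WQ t : W t <= 2 ^ t * size Q.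
  rewrite -size_strings -sum1_size big_distrl /=; apply: leq_sum => r _.
  by rewrite mul1n count_size.
(* The mean weight [W s / 2 ^ s] is raised to [k * 2 ^ -n] by [k] successive failures; the choice of
   [k] below exceeds the bound [size Q]. *)
have grow k : exists s, k * 2 ^ s <= 2 ^ n * W s.
  elim: k => [|k [s IH]]; first by exists 0.
  have /existsNP[t /negP] := unst s; have [ts|st] := leqP t s.
    by rewrite stable_small.
  move: (ltnW st) => /subnKC <-; rewrite /stable -ltnNge => H.
  exists (s + (t - s)).
  have : count (changed s) (strings (s + (t - s))) + 2 ^ (t - s) * W s <=
      W (s + (t - s)).
    rewrite -sum_strings_take -sum_bool_count -big_split; apply: leq_sum => r _.
    exact: changed_weight.
  rewrite -(leq_pmul2l (expn_gt0 2 n)) => /(leq_trans _); apply.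
  rewrite mulSn mulnDr leq_add // 1?mulnC ?(ltnW H) //.
  have := leq_mul (leqnn (2 ^ (t - s))) IH.
  by congr (_ <= _); rewrite ?expnD; ring.
have [s] := grow (2 ^ n * size Q).+1.
apply/negP; rewrite -ltnNge.
apply: leq_ltn_trans (_ : 2 ^ n * size Q * 2 ^ s < _).
  by rewrite -mulnA leq_mul2l [size Q * _]mulnC WQ orbT.
by rewrite ltn_pmul2r ?expn_gt0.
Qed.
End Stabilisation.

(** * Measure of open classes *)

Section Cover.
Variables (K : realType) (D : pred (seq bool)) (n c : nat).
Hypothesis D_take : forall m r, D (take m r) -> D r.
Hypothesis D_count : forall t, count D (strings t) * 2 ^ n <= c * 2 ^ t.

(** These strings form a prefix-free set generating the same open class as [D]. As [D] is closed
    under extension, only the immediate predecessor has to be tested. *)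
Definition minimal_string (r : seq bool) : bool :=
  D r && ((r == [::]) || ~~ D (take (size r).-1 r)).

Lemma minimal_prefix r x y : minimal_string x -> minimal_string y ->
  take (size x) r = x -> take (size y) r = y -> x = y.
Proof.
wlog xy : x y / size x <= size y.
  by move=> H Mx My tx ty; case/orP: (leq_total (size x) (size y)) => /H{}H;
     [apply: H|apply/esym/H].
move=> /andP[Dx _] /andP[_ My] tx ty.
move: xy; rewrite leq_eqVlt => /predU1P[e|xy]; first by rewrite -tx e.
have y0 : y != [::] by case: (y) xy.
move: My; rewrite (negbTE y0) /= => /negP[]; apply: (@D_take (size x)).
have y1 : size x <= (size y).-1 by lia.
by rewrite take_takel // -ty take_takel ?tx // ltnW.
Qed.

(** Double counting, as for the Kraft inequality: [2 ^ t / 2 ^ size x] counts the extensions of [x]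
    of length [t]; they lie in [D], and by [minimal_prefix] none extends two members of [L]. *)
Lemma sum_minimal_strings (L : seq (seq bool)) t : uniq L ->
  all minimal_string L -> all (fun x => size x <= t) L ->
  (\sum_(x <- L) 2 ^- size x <= (count D (strings t))%:R / 2 ^+ t :> K)%R.
Proof.
move=> uL /allP ML /allP tL.
rewrite ler_pdivlMr ?exprn_gt0 // mulr_suml.
have -> : (\sum_(x <- L) 2 ^- size x * 2 ^+ t =
    (\sum_(x <- L) count (fun r =>
      take (size x) r == x) (strings t))%:R :> K)%R.
  rewrite natr_sum !big_seq; apply: eq_bigr => x /tL xt.
  rewrite -(subnKC xt) (count_strings_take (pred1 x)).
  rewrite count_uniq_mem ?uniq_strings //.
  by rewrite mem_strings eqxx muln1 natrX exprD mulKf // expf_neq0 // pnatr_eq0.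
rewrite ler_nat -[leqRHS]sum_bool_count.
under eq_bigr do rewrite -sum_bool_count.
rewrite exchange_big /=; apply: leq_sum => r _; rewrite sum_bool_count.
case: (hasP (s := L) (a := fun x => take (size x) r == x)) =>
  [[x xL /eqP tx]|none].
  have -> : D r by apply: (@D_take (size x)); rewrite tx; case/andP: (ML _ xL).
  apply: (@leq_trans (count_mem x L)); last by rewrite count_uniq_mem // xL.
  rewrite (@eq_in_count _ _ (pred1 x)) // => y yL /=.
  apply/eqP/eqP => [ty|->//]; apply: (@minimal_prefix r) => //; exact: ML.
rewrite (_ : count _ _ = 0) //; apply/eqP; rewrite eqn0Ngt -has_count;
  apply/hasP => -[x xL tx].
by case: none; exists x.
Qed.

(** The minimal strings of [D] contribute at most [c / 2 ^ n]; the extra [1 / 2 ^ n] pays for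
    padding the cover. *)
Lemma coin_measure_le (S : set (set nat)) :
  (forall X, S X -> exists m, D (restr X m)) ->
  (coin_measure K S <= (c.+1%:R / 2 ^+ n)%:E)%E.
Proof.
move=> SD.
(* A cover is an infinite sequence of cylinders, so the indices that are not
   needed get cylinders of total measure at most [2 ^ -n]. *)
pose filler k := nseq (n + k.+1) false.
pose C k := if pickle_inv k is Some x
  then if minimal_string x then x else filler k else filler k.
suff HC : (\sum_(0 <= k <oo) ((2 ^- size (C k))%R : K)%:E <=
           (c.+1%:R / 2 ^+ n)%:E)%E.
  apply: le_trans HC; apply: ereal_inf_lbound; exists C => // X /SD Dm.
  have [m Dm' m_min] := ex_minnP Dm.
  exists (pickle (restr X m)) => //; rewrite /C pickleK_inv.
  have -> : minimal_string (restr X m).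
    rewrite /minimal_string Dm' size_restr; case: m Dm' m_min => // m _ m_min.
    rewrite take_restr (minn_idPl (leqnSn m)); apply/orP; right.
    by apply/negP => /m_min; rewrite ltnn.
  by rewrite /cylinder /= size_restr.
apply: lime_le; first by apply: is_cvg_nneseries => k _ _;
  rewrite lee_fin invr_ge0 exprn_ge0.
apply: nearW => N; rewrite sumEFin lee_fin.
pose g k : K := if pickle_inv k is Some x
  then if minimal_string x then (2 ^- size x)%R else 0%R else 0%R.
have Cg k : (2 ^- size (C k) <= g k + 2 ^- (n + k.+1) :> K)%R.
  have f0 : (0 <= 2 ^- (n + k.+1) :> K)%R by rewrite invr_ge0 exprn_ge0.
  rewrite /C /g; case: pickle_inv => [x|]; last by rewrite size_nseq add0r.
  by case: ifP => _; rewrite ?size_nseq ?add0r // lerDl.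
apply: le_trans (ler_sum _ (fun k _ => Cg k)) _; rewrite big_split /=.
rewrite -[c.+1]addn1 natrD mulrDl lerD //; last first.
  have geom M :
      (\sum_(0 <= k < M) 2 ^- (n + k.+1) = 2 ^- n - 2 ^- (n + M) :> K)%R.
    elim: M => [|M IH]; first by rewrite big_geq // addn0 subrr.
    rewrite big_nat_recr //= IH addnS !exprS; field.
    by rewrite ?expf_neq0 ?pnatr_eq0 /=.
  by rewrite geom div1r lerBlDr lerDl invr_ge0 exprn_ge0.
pose L := seq.filter minimal_string (pmap pickle_inv (iota 0 N)).
have -> : (\sum_(0 <= k < N) g k = \sum_(x <- L) 2 ^- size x :> K)%R.
  rewrite big_filter /index_iota subn0.
  elim: (iota 0 N) => [|k s IH]; first by rewrite !big_nil.
  rewrite big_cons {}IH /g /=; case: pickle_inv => [x|] /=; rewrite ?add0r //.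
  by rewrite big_cons; case: ifP => _; rewrite ?add0r.
pose t := \max_(x <- L) size x.
apply: le_trans (sum_minimal_strings (t := t) _ _ _) _.
- by rewrite filter_uniq // (pmap_uniq (@pickle_invK _)) // iota_uniq.
- exact: filter_all.
- by apply/allP => x xL; apply: leq_bigmax_seq.
rewrite ler_pdivrMr ?exprn_gt0 // mulrAC ler_pdivlMr ?exprn_gt0 //.
by rewrite -!natrX -!natrM ler_nat.
Qed.
End Cover.

(** * The diagonal construction *)

Lemma prog_code_inj : injective prog_code.
Proof.
elim=> [|||||p IHp q IHq|p IHp q IHq|p IHp q IHq|p IHp];
  case=> [|||||p' q'|p' q'|p' q'|p'] //= /npair_inj[] //.
1-3: by move=> _ /npair_inj[/IHp-> /IHq->].
by move=> _ /IHp->.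
Qed.

Lemma jump_prog_code A p : jump A (prog_code p) <-> halts A p (prog_code p).
Proof. by split=> [[q /prog_code_inj->]//|H]; exists p. Qed.

Lemma peval_mu_total A p f x y : (forall z, peval A p z (f z)) ->
  (peval A (Mu p) x y <-> f (npair x y) = 0 /\ forall i, i < y ->
  f (npair x i) != 0).
Proof.
move=> pf; split=> [[py lty]|[fy lty]].
  split=> [|i /lty[k pk]]; first exact: peval_fun (pf _) py.
  by rewrite (peval_fun (pf _) pk).
split=> [|i /lty]; first by rewrite -fy.
by have := pf (npair x i); case: (f _) => // k pk _; exists k.
Qed.

Lemma halts_mu_total A p f x : (forall z, peval A p z (f z)) ->
  (halts A (Mu p) x <-> exists y, f (npair x y) = 0).
Proof.
move=> pf; split=> [[y /(peval_mu_total _ _ pf)[fy _]]|[y /eqP fy]];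
  first by exists y.
have ex_z : exists z, f (npair x z) == 0 by exists y.
have [z /eqP fz z_min] := ex_minnP ex_z.
exists z; apply/(peval_mu_total _ _ pf); split=> // i; rewrite ltnNge.
exact/contra/z_min.
Qed.

Lemma halts_comp_total A p q x y : peval A q x y ->
  (halts A (Comp p q) x <-> halts A p y).
Proof.
move=> qy; split=> [[z [u qu pu]]|[z pz]]; last by exists z, y.
by exists z; rewrite (peval_fun qy qu).
Qed.

Definition const_code n := prog_code (const_prog n).

Lemma cmp_const_code (E : encType) (f : E -> nat) :
  cmp f -> cmp (fun e => const_code (f e)).
Proof.
(* The iteration starts from the code of [Zero] and turns the code of [q] into that of
   [Comp Succ q]. *)
move=> cf; apply: (@cmp_ext _ _ (fun e =>
    iter (f e) (fun c => npair 6 (npair (npair 1 0) c)) (npair 0 0))).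
  by move=> e; rewrite /const_code; elim: (f e) => //= n ->.
by cmp.
Qed.

(* The jump feeds [with_param p j] its own code [e]; the program then runs [p]
   on [(e, j)], and the code of [p] can be read off [e]. *)
Definition with_param p j := Comp p (Pair id_prog (const_prog j)).

Definition with_param_code c j :=
  npair 6 (npair c (npair 5 (npair (prog_code id_prog) (const_code j)))).

Lemma jump_with_param A p j (e := with_param_code (prog_code p) j) :
  jump A e <-> halts A p (npair e j).
Proof.
rewrite (jump_prog_code A (with_param p j)); apply: halts_comp_total.
by exists e, j; split=> //; [apply: peval_id|apply: peval_const].
Qed.

Lemma cmp_strings (E : encType) (n : E -> nat) :
  cmp n -> cmp (fun e => strings (n e)).
Proof. by move=> cn; rewrite /strings; cmp. Qed.

Ltac cmp_user ::=
  match goal with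
  | |- cmp (fun e => halts_within _ _) => apply: cmp_halts_within
  | |- cmp (fun e => const_code _) => apply: cmp_const_code
  | |- cmp (fun e => strings _) => apply: cmp_strings
  end.

Section Diagonal.
Variable t : nat -> ttcond.
Hypothesis cmp_t : cmp t.

(** The parameter [npair n i] asks for bit [i] of the [n]-th string. In the end [c] is the code of
    the program of [diagonal_prog]; until then it is arbitrary. *)
Definition block c n := [seq with_param_code c (npair n i) | i <- iota 0 n].

Definition queries c n := flatten [seq (t x).1 | x <- block c n].

(** For a prefix [r] of X, this is the approximation to Gamma(X, n), with X' replaced by the
    programs seen to halt on [r]. *)
Definition tt_answers c n r :=
  [seq [seq halts_within r q | q <- (t x).1] \in (t x).2 | x <- block c n].

Definition block_stable c n s m := stable halts_within (queries c n) n s m.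

(* The default [[::]] of [head] is never reached, by [strings_pigeonhole]. *)
Definition rare c n s := head [::] [seq sg <- strings n |
  count (fun r => tt_answers c n r == sg) (strings s) * 2 ^ n <= 2 ^ s].

(* Computable approximation to the 0'-computable [limit_stage] below. *)
Definition stage c n m := find (fun s => block_stable c n s m) (iota 0 m.+1).

Lemma cmp_tt_answers (E : encType) (c n : E -> nat) (r : E -> seq bool) :
  cmp c -> cmp n -> cmp r -> cmp (fun e => tt_answers (c e) (n e) (r e)).
Proof.
by move=> cc cn cr; rewrite /tt_answers /block /with_param_code; cmp.
Qed.

Lemma cmp_rare (E : encType) (c n s : E -> nat) :
  cmp c -> cmp n -> cmp s -> cmp (fun e => rare (c e) (n e) (s e)).
Proof. by move=> cc cn cs; rewrite /rare; cmp; apply: cmp_tt_answers; cmp. Qed.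

Lemma cmp_block_stable (E : encType) (c n s m : E -> nat) :
  cmp c -> cmp n -> cmp s -> cmp m ->
  cmp (fun e => block_stable (c e) (n e) (s e) (m e)).
Proof.
move=> cc cn cs cm; rewrite /block_stable /stable /changed /queries /block.
by rewrite /with_param_code; cmp.
Qed.

Lemma cmp_stage (E : encType) (c n m : E -> nat) :
  cmp c -> cmp n -> cmp m -> cmp (fun e => stage (c e) (n e) (m e)).
Proof.
by move=> cc cn cm; rewrite /stage; cmp; apply: cmp_block_stable; cmp.
Qed.

Lemma size_tt_answers c n r : size (tt_answers c n r) = n.
Proof. by rewrite !size_map size_iota. Qed.

Lemma rareP c n s : rare c n s \in strings n /\
  count (fun r => tt_answers c n r == rare c n s) (strings s) * 2 ^ n <= 2 ^ s.
Proof.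
have [sg sgn sgP] := strings_pigeonhole s (size_tt_answers c n).
rewrite /rare; set p := (X in seq.filter X _).
have : sg \in seq.filter p (strings n) by rewrite mem_filter /p sgP.
case E : (seq.filter p _) => [//|sg' L] _ /=.
have : sg' \in seq.filter p (strings n) by rewrite E mem_head.
by rewrite mem_filter => /andP[].
Qed.

Lemma mem_queries c n i q : i < n ->
  q \in (t (with_param_code c (npair n i))).1 -> q \in queries c n.
Proof.
move=> ni qt; apply/flatten_mapP; exists (with_param_code c (npair n i)) => //.
by apply/mapP; exists i; rewrite // mem_iota.
Qed.

Lemma nth_tt_answers c n r i (x := with_param_code c (npair n i)) : i < n ->
  nth false (tt_answers c n r) i =
  ([seq halts_within r q | q <- (t x).1] \in (t x).2).
Proof.
by move=> ni; rewrite !(nth_map 0) ?size_map ?size_iota // nth_iota.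
Qed.

Lemma eq_tt_answers c n r r' :
  {in queries c n, halts_within r =1 halts_within r'} ->
  tt_answers c n r = tt_answers c n r'.
Proof.
move=> rr'; apply: (@eq_from_nth _ false); rewrite !size_tt_answers // => i ni.
rewrite !nth_tt_answers //; congr in_mem.
by apply/eq_in_map => q /(mem_queries ni); apply: rr'.
Qed.

Definition limit_stage c n s :=
  (forall m, block_stable c n s m) /\
  (forall s', s' < s -> exists m, ~~ block_stable c n s' m).

Lemma limit_stage_ex c n : exists s, limit_stage c n s.
Proof.
have ex_s : exists s, `[< forall m, block_stable c n s m >].
  have [|s sP] := @eventually_stable halts_within (queries c n) _ n.
    by move=> r m q; apply: halts_within_take.
  by exists s; apply/asboolP.
have [s /asboolP sP s_min] := ex_minnP ex_s.
exists s; split=> // s' ss'; apply: contrapT => /forallNP H.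
suff /s_min : `[< forall m, block_stable c n s' m >] by rewrite leqNgt ss'.
by apply/asboolP => m; apply: contrapT => /negP /H.
Qed.

Lemma block_stable_le c n s m m' :
  m <= m' -> block_stable c n s m' -> block_stable c n s m.
Proof. by apply: stable_le => r k q; apply: halts_within_take. Qed.

(** The finitely many stages below [s] are all refuted by one common length, and remain refuted by
    [block_stable_le]; [s] itself is never refuted. *)
Lemma stage_limit c n s : limit_stage c n s ->
  exists m0, forall m, m0 <= m -> stage c n m = s.
Proof.
move=> [sP s_min].
have [m1 m1P] : exists m1, forall s', s' < s -> ~~ block_stable c n s' m1.
  elim: s {sP} s_min => [|s IH] s_min; first by exists 0.
  have [|m1 H1] := IH; first by move=> s' ss'; apply/s_min/ltnW.
  have [m2 H2] := s_min s (ltnSn s).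
  exists (maxn m1 m2) => s'; rewrite ltnS leq_eqVlt => /predU1P[->|/H1 {}H1].
    by apply: contra H2; apply: block_stable_le; apply: leq_maxr.
  by apply: contra H1; apply: block_stable_le; apply: leq_maxl.
exists (maxn s m1) => m; rewrite geq_max => /andP[sm m1m].
have lt_s s' : s' < s -> block_stable c n s' m = false.
  by move=> /m1P/negbTE H; apply: contraFF H; apply: block_stable_le.
rewrite /stage; set p := (X in find X _).
have H : has p (iota 0 m.+1).
  by apply/hasP; exists s; [rewrite mem_iota /= add0n ltnS|apply: sP].
have fm : find p (iota 0 m.+1) < m.+1.
  by rewrite -[X in _ < X](size_iota 0) -has_find.
have := nth_find 0 H; rewrite nth_iota // add0n.
case: (ltngtP (find p (iota 0 m.+1)) s) => // [/lt_s|s_find _].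
  by rewrite /p => ->.
have := before_find 0 s_find; rewrite nth_iota // add0n.
by rewrite /p sP.
Qed.

(* [f] tests stability; [search] halts iff the given stage is unstable; [g] maps
   a stage to the code of its [search]; [h] vanishes iff the bit is 1. The
   program finds the limit stage by asking the oracle 0' along [g], and then
   halts iff [h] vanishes there. *)
Lemma diagonal_prog : exists p, forall n i s (c := prog_code p),
  limit_stage c n s -> jump (jump set0) (with_param_code c (npair n i)) <->
                       nth false (rare c n s) i.
Proof.
have : cmp (fun z : nat * nat * nat * nat =>
    block_stable z.1.1.1 z.1.1.2 z.1.2 z.2) by apply: cmp_block_stable; cmp.
case=> f /computable_any_oracle[pf pfP] ff.
pose search z := Comp (Mu pf) (const_prog z).
have searchP c n s : jump set0 (prog_code (search (enc (c, n, s)))) <->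
    exists m, ~~ block_stable c n s m.
  rewrite jump_prog_code (halts_comp_total _ (peval_const _ _ _)).
  rewrite (halts_mu_total _ (pfP _)).
  by split=> -[m] => [|/negbTE] H; exists m; move: (ff (c, n, s, m)) H;
    rewrite /= => -> //; case: block_stable.
(* Here [z] consists of the program's own code [e], the parameter [npair n i] and a stage;
   [nfst (nsnd e)] is [c], and 6 is the tag of [Comp]. *)
have : cmp (fun z : nat * nat * nat =>
    npair 6 (npair (prog_code (Mu pf)) (const_code
      (enc (nfst (nsnd z.1.1), nfst z.1.2, z.2))))) by cmp.
case=> g /computable_any_oracle[pg pgP] gg.
(* The last component is the search variable of [Mu]. The value does not depend on it, so the search
   stops at once or never. *)
have : cmp (fun z : nat * nat * nat * nat =>
  ~~ nth false (rare (nfst (nsnd z.1.1.1)) (nfst z.1.1.2) z.1.2)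
       (nsnd z.1.1.2)).
  by cmp; apply: cmp_rare; cmp.
case=> h /computable_any_oracle[ph phP] hh.
exists (Comp (Mu ph) (Pair id_prog (Mu (Comp Oracle pg)))) =>
  n i s c [sP s_min].
rewrite jump_with_param.
set e := with_param_code c (npair n i).
have ce : nfst (nsnd e) = c by rewrite nsndK nfstK.
pose o z := nat_of_bool `[< jump set0 (g z) >].
have oP z : peval (jump set0) (Comp Oracle pg) z (o z) by exists (g z).
have oE s' : o (npair (npair e (npair n i)) s') =
             nat_of_bool `[< exists m, ~~ block_stable c n s' m >].
  have := gg (e, npair n i, s'); rewrite /o /= => ->; rewrite ce nfstK.
  by congr nat_of_bool; apply: asbool_equiv_eq; apply: searchP.
(* The inner [Mu] returns the first stage whose search for instability fails, that is, where the
   oracle answers 0: the limit stage [s]. *)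
rewrite (@halts_comp_total _ _ _ _ (npair (npair e (npair n i)) s)); last first.
  exists (npair e (npair n i)), s; split=> //; first exact: peval_id.
  apply/(peval_mu_total _ _ oP); split=> [|s' /s_min H]; rewrite oE.
    by rewrite asboolF // => -[m]; rewrite sP.
  by rewrite asboolT.
rewrite (halts_mu_total _ (phP _)).
have hE k : h (npair (npair (npair e (npair n i)) s) k) =
            nat_of_bool (~~ nth false (rare c n s) i).
  by have := hh (e, npair n i, s, k); rewrite /= => ->; rewrite ce nfstK nsndK.
by split=> [[k]|b]; [rewrite hE; case: nth|exists 0; rewrite hE b].
Qed.

End Diagonal.

(** * The null class and the contradiction *)

Lemma halts_within_eventually X (Q : seq nat) : exists m0, forall m, m0 <= m ->
  {in Q, forall q, halts_within (restr X m) q = `[< jump X q >]}.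
Proof.
elim: Q => [|q Q [m1 H1]]; first by exists 0.
have [m2 H2] : exists m2, forall m, m2 <= m ->
    halts_within (restr X m) q = `[< jump X q >].
  have [/jump_halts_within[m2 H]|nj] := pselect (jump X q).
    exists m2 => m m2m; rewrite asboolT; last first.
      by apply/jump_halts_within; exists m2.
    by apply: (@halts_within_take _ m2); rewrite take_restr (minn_idPl m2m).
  exists 0 => m _; rewrite asboolF //; apply/negP => H.
  by apply/nj/jump_halts_within; exists m.
exists (maxn m1 m2) => m; rewrite geq_max => /andP[m1m m2m] q'.
by rewrite inE => /predU1P[->|]; [apply: H2|apply: H1].
Qed.

Lemma null_class_le (K : realType) (S : set (set nat)) (c : nat) :
  (forall n, (coin_measure K S <= (c%:R / 2 ^+ n)%:E)%E) -> null_class K S.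
Proof.
move=> H; apply/eqP; rewrite eq_le; apply/andP; split.
  apply/lee_addgt0Pr => e e0; rewrite add0e.
  have [n ne] : exists n, (c%:R / e <= 2 ^+ n :> K)%R.
    exists (Num.bound (c%:R / e)).
    apply: ltW; apply: (lt_le_trans (archi_boundP _)).
      by rewrite divr_ge0 // ltW.
    by rewrite -natrX ler_nat ltnW // ltn_expl.
  apply: le_trans (H n) _; rewrite lee_fin ler_pdivrMr ?exprn_gt0 //.
  by rewrite mulrC -ler_pdivrMr.
apply/ereal_infP => _ [C _ <-]; apply: nneseries_ge0 => k _ _.
by rewrite lee_fin invr_ge0 exprn_ge0.
Qed.

Theorem corollary3p4 (K : realType) :
  ~ exists R : set nat, superhigh R /\ weakly_2_random K R.
Proof.
move=> [R [[t [t_comp tP]] R_rand]].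
have cmp_t : cmp t.
  have [p pP] := t_comp; exists (fun n => ttcond_code (t n)) => // n.
  by rewrite /= /enc_prod /enc_seq /ttcond_code /= /enc_seq map_id.
have [p pP] := diagonal_prog cmp_t.
set c := prog_code p in pP.
(* Here [k] codes a pair [(n, u)]: agreement on block [n] is demanded at some stage not before
   [u]. *)
pose P k r := (nsnd k <= size r) &&
  (tt_answers t c (nfst k) r ==
   rare t c (nfst k) (stage t c (nfst k) (size r))).
(* Both sides of the equation in [P] converge, so asking for infinitely many
   agreements is asking for equality of the limits. *)
pose S := [set X | forall k, exists m, P k (restr X m)].
have S_Pi02 : Pi02_class S.
  exists P => //; rewrite /P.
  have : cmp (fun z : nat * seq bool => P z.1 z.2).
    rewrite /P; cmp; first by apply: cmp_tt_answers; cmp.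
    by apply: cmp_rare; cmp; apply: cmp_stage; cmp.
  by case=> f fc ff; exists f => // n s; apply: (ff (n, s)).
apply: (R_rand S) => //.
  (* One [2 ^ -n] each for the rare string at stage [s], for later changes, and for the padding in
     [coin_measure_le]. *)
  apply: (@null_class_le _ _ 3) => n.
  have [s sP] := limit_stage_ex t c n.
  have [m0 m0P] := stage_limit sP.
  pose D r := (s <= size r) && (tt_answers t c n (take s r) == rare t c n s)
              || changed halts_within (queries t c n) s r.
  apply: (@coin_measure_le _ D n 2).
  - move=> m r /orP[/andP[sr H]|H]; apply/orP; last first.
      by right; apply: changed_take H => ? ? ?; apply: halts_within_take.
    move: sr; rewrite size_take_min leq_min => /andP[sm sr]; left.
    by rewrite sr; move: H; rewrite take_takel.
  - move=> u; rewrite /D.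
    have [_ rP] := rareP t c n s.
    have cP : block_stable t c n s u by case: sP.
    pose D1 r := (s <= size r) && (tt_answers t c n (take s r) == rare t c n s).
    pose D2 := changed halts_within (queries t c n) s.
    apply: leq_trans
      (_ : (count D1 (strings u) + count D2 (strings u)) * 2 ^ n <= _).
      by rewrite leq_mul2r -count_predUI leq_addr orbT.
    rewrite mulnDl mul2n -addnn leq_add //.
    have [su|us] := leqP s u; last first.
      rewrite (@eq_in_count _ _ pred0) ?count_pred0 // => r.
      by rewrite mem_strings /D1 => /eqP ->; rewrite leqNgt us.
    rewrite -(subnKC su).
    apply: leq_trans (_ : 2 ^ (u - s) * count (fun r =>
      tt_answers t c n r == rare t c n s) (strings s) * 2 ^ n <= _).
      rewrite -count_strings_take leq_mul2r; apply/orP; right.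
      by apply: sub_count => r /= /andP[].
    by rewrite -mulnA expnD [2 ^ s * _]mulnC leq_mul2l rP orbT.
  (* From [m0] on [stage] has its limit [s]. If no query changes after [s], the agreement at [m] is
     already one at stage [s]. *)
  - move=> X XS; have [m] := XS (npair n (maxn m0 s)).
    rewrite /P nfstK nsndK size_restr geq_max => /andP[/andP[m0m sm]].
    rewrite m0P // => /eqP rE; exists m; rewrite /D size_restr sm.
    case: (boolP (changed _ _ _ _)) => [_|/hasPn nch]; first by rewrite orbT.
    rewrite orbF -rE; apply/eqP; apply: eq_tt_answers => q /nch.
    have := @halts_within_take (restr X m) s q.
    by case: (halts_within (take s _) q); case: (halts_within _ q) => // ->.
move=> k; rewrite /P; move: (nfst k) (nsnd k) => n u.
have [s sP] := limit_stage_ex t c n.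
have [m0 m0P] := stage_limit sP.
have [m1 m1P] := halts_within_eventually R (queries t c n).
pose m := maxn u (maxn m0 m1); exists m.
have [um m0m m1m] : [/\ u <= m, m0 <= m & m1 <= m] by rewrite /m; split; lia.
rewrite size_restr um m0P //=; apply/eqP.
have [rn _] := rareP t c n s; move: rn; rewrite mem_strings => /eqP rn.
apply: (@eq_from_nth _ false); rewrite size_tt_answers ?rn // => i ni.
rewrite nth_tt_answers //; set x := with_param_code _ _.
have -> : [seq halts_within (restr R m) q | q <- (t x).1] =
          [seq `[< jump R q >] | q <- (t x).1].
  by apply/eq_in_map => q /(mem_queries ni); apply: m1P.
(* Both bits decide whether [x] is in 0'': the answer of [t] by the reduction to R', the bit of
   [rare] by [diagonal_prog]. *)
by apply/idP/idP => [/tP/(pP _ _ _ sP)|/(pP _ _ _ sP)/tP].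
Qed.
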